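(* Let $(\pmb{u}_{1,m},\pmb{u}_{2,m})_{0\le m\le M}$ be the fully discrete localized ETD1 (respectively localized ETD2) multidomain solution, and let $(\pmb{u}_{1,m}^{(k)},\pmb{u}_{2,m}^{(k)})_{0\le m\le M}$, $k\ge1$, be the iterates of the global-in-time, iterative, localized ETD1 (respectively ETD2) algorithm (Method 2), started from arbitrary initial guesses $(\pmb{u}_{1,m}^{(0)}(N_\alpha))_{1\le m\le M}$ and $(\pmb{u}_{2,m}^{(0)}(N_{\beta,\alpha}))_{1\le m\le M}$ (all defined in the context). Then, in both the ETD1 and the ETD2 case, the iterates converge to the localized ETD solution as $k\to\infty$: $$\|\pmb{u}_1^{(k)}-\pmb{u}_1\|_{\infty,T}+\|\pmb{u}_2^{(k)}-\pmb{u}_2\|_{\infty,T}\to 0\quad\text{as }k\to\infty .$$ In particular, with $\kappa(\alpha,\beta)=\frac{\alpha(1-\beta)}{\beta(1-\alpha)}$, for all $k\ge 0$, $$\|\pmb{u}_1^{(2k+1)}-\pmb{u}_1\|_{\infty,T}\le\left(\kappa(\alpha,\beta)\right)^k\,\left|\pmb{u}_{2,\cdot}^{(0)}(N_{\beta,\alpha})-\pmb{u}_{2,\cdot}(N_{\beta,\alpha})\right|_T,$$ $$\|\pmb{u}_2^{(2k+1)}-\pmb{u}_2\|_{\infty,T}\le\left(\kappa(\alpha,\beta)\right)^k\,\left|\pmb{u}_{1,\cdot}^{(0)}(N_\alpha)-\pmb{u}_{1,\cdot}(N_\alpha)\right|_T .$$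
   Context: Setting: the 1D diffusion equation $\partial_t u=\nu\,\partial_{xx}u+f(x,t)$ on $0<x<L$, $0<t\le T$, with $\nu>0$ constant, $u(0,t)=\psi_1(t)$, $u(L,t)=\psi_2(t)$, $u(x,0)=u_0(x)$, is discretized in space on the uniform grid $jh$, $h=L/(N+1)$, and in time with $\Delta t=T/M$, $t_m=m\Delta t$, $0\le m\le M$. For $n\ge1$, $\pmb{A}_{(n)}$ is the $n\times n$ tridiagonal matrix equal to $\frac{\nu}{h^2}$ times the matrix with $-2$ on the diagonal, $1$ on the first sub- and super-diagonals and $0$ elsewhere. $\pmb{I}$ is the identity matrix. The $j$-th component of a vector $\pmb{v}$ is written $\pmb{v}(j)$. Overlapping decomposition: $0<\alpha<\beta<1$, $\alpha L=N_\alpha h$, $\beta L=N_\beta h$ with integers $1<N_\alpha<N_\beta<N$; $N_1=N_\beta-1$, $N_2=N-N_\alpha$, $N_{\beta,\alpha}=N_\beta-N_\alpha$; $\pmb{A}_1=\pmb{A}_{(N_1)}$, $\pmb{A}_2=\pmb{A}_{(N_2)}$. For numbers $a,b$, the vector $\pmb{F}_1(f(t),a,b)\in\mathbb{R}^{N_1}$ has $j$-th entry $f(jh,t)$, plus $\frac{\nu}{h^2}a$ added to the first entry and $\frac{\nu}{h^2}b$ added to the last entry; the vector $\pmb{F}_2(f(t),a,b)\in\mathbb{R}^{N_2}$ has $j$-th entry $f((N_\alpha+j)h,t)$, plus $\frac{\nu}{h^2}a$ added to the first entry and $\frac{\nu}{h^2}b$ added to the last entry. Initial vectors: $\pmb{u}_{1,0}(j)=u_0(jh)$,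 $1\le j\le N_1$, and $\pmb{u}_{2,0}(j)=u_0((j+N_\alpha)h)$, $1\le j\le N_2$. Write $\Phi_i=\pmb{A}_i^{-1}(e^{\Delta t\pmb{A}_i}-\pmb{I})$ and $\Psi_i=(\Delta t)^{-1}\pmb{A}_i^{-2}(e^{\Delta t\pmb{A}_i}-\pmb{I}-\Delta t\pmb{A}_i)$, $i=1,2$. Localized multidomain solutions: set $\pmb{F}_{1,m}=\pmb{F}_1(f(t_m),\psi_1(t_m),\pmb{u}_{2,m}(N_{\beta,\alpha}))$, $\pmb{F}_{2,m}=\pmb{F}_2(f(t_m),\pmb{u}_{1,m}(N_\alpha),\psi_2(t_m))$. The localized ETD1 solution satisfies, for $m=0,\dots,M-1$ and $i=1,2$, the coupled equations $\pmb{u}_{i,m+1}=e^{\Delta t\pmb{A}_i}\pmb{u}_{i,m}+\Phi_i\pmb{F}_{i,m+1}$; the localized ETD2 solution satisfies $\pmb{u}_{i,m+1}=e^{\Delta t\pmb{A}_i}\pmb{u}_{i,m}+\Phi_i\pmb{F}_{i,m}+\Psi_i(\pmb{F}_{i,m+1}-\pmb{F}_{i,m})$; both start from the initial vectors above. Method 2 (global-in-time, iterative, localized ETD): for all $k\ge 1$, $\pmb{u}_{i,0}^{(k)}=\pmb{u}_{i,0}$, and at $m=0$ the interface values are, for every $k\ge0$, $\pmb{u}_{1,0}^{(k)}(N_\alpha)=u_0(N_\alpha h)$, $\pmb{u}_{2,0}^{(k)}(N_{\beta,\alpha})=u_0(N_\beta h)$. Set $\pmb{F}_{1,m}^{(k)}=\pmb{F}_1(f(t_m),\psi_1(t_m),\pmb{u}_{2,m}^{(k)}(N_{\beta,\alpha}))$,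 $\pmb{F}_{2,m}^{(k)}=\pmb{F}_2(f(t_m),\pmb{u}_{1,m}^{(k)}(N_\alpha),\psi_2(t_m))$. For $k=0,1,\dots$, $m=0,\dots,M-1$, $i=1,2$: with ETD1, $\pmb{u}_{i,m+1}^{(k+1)}=e^{\Delta t\pmb{A}_i}\pmb{u}_{i,m}^{(k+1)}+\Phi_i\pmb{F}_{i,m+1}^{(k)}$; with ETD2, $\pmb{u}_{i,m+1}^{(k+1)}=e^{\Delta t\pmb{A}_i}\pmb{u}_{i,m}^{(k+1)}+\Phi_i\pmb{F}_{i,m}^{(k)}+\Psi_i(\pmb{F}_{i,m+1}^{(k)}-\pmb{F}_{i,m}^{(k)})$. Norms: $\|\pmb{v}\|_{\infty,T}=\max_{1\le m\le M}\max_j|\pmb{v}_m(j)|$ ($j$ over all components) and $|\pmb{v}_{\cdot}(j)|_T=\max_{1\le m\le M}|\pmb{v}_m(j)|$. *)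

(* Defs.v *)
From HB Require Import structures.
From mathcomp Require Import all_boot all_order all_algebra.
From mathcomp Require Import all_classical all_reals all_analysis.

Set Implicit Arguments.
Unset Strict Implicit.
Unset Printing Implicit Defensive.

Import Order.TTheory GRing.Theory Num.Theory.
Import numFieldNormedType.Exports.

Local Open Scope classical_set_scope.
Local Open Scope ring_scope.

Section Matrices.
Context {R : realType}.

(* The limit is taken in 'M[R]_n with its product (sup-norm) topology. *)
Definition expmx n (A : 'M[R]_n) : 'M[R]_n :=
  limn (series (fun k : nat => (k`!%:R)^-1 *: A ^+ k)).

Definition laplacian_mx (nu h : R) n : 'M[R]_n :=
  (nu / h ^+ 2) *: \matrix_(i < n, j < n)
    (if i == j then - 2 else
     if (i.+1 == j :> nat) || (j.+1 == i :> nat) then 1 else 0).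

Definition Phi (dt : R) n (A : 'M[R]_n) : 'M[R]_n :=
  invmx A *m (expmx (dt *: A) - 1%:M).

Definition Psi (dt : R) n (A : 'M[R]_n) : 'M[R]_n :=
  dt^-1 *: (invmx A *m invmx A *m (expmx (dt *: A) - 1%:M - dt *: A)).

(* Components are numbered from 1: v(j) is [entry v j] for 1 <= j <= n,
   and [entry v j] is the junk value 0 for j outside this range. *)
Definition entry n (v : 'cV[R]_n) (j : nat) : R :=
  if j is j'.+1 then (if insub j' is Some i then v i 0 else 0) else 0.

Definition load_vec (nu h : R) n (g : nat -> R) (a b : R) : 'cV[R]_n :=
  \col_(i < n) (g i.+1
    + (if i == 0%N :> nat then nu / h ^+ 2 * a else 0)
    + (if i.+1 == n then nu / h ^+ 2 * b else 0)).

Definition time_max (M : nat) (a : nat -> R) : R :=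
  \big[Num.max/0]_(1 <= m < M.+1) `|a m|.

Definition time_sup_norm (M n : nat) (v : nat -> 'cV[R]_n) : R :=
  \big[Num.max/0]_(1 <= m < M.+1) \big[Num.max/0]_(j < n) `|v m j 0|.

End Matrices.

Variant etd_scheme := ETD1 | ETD2.

(* F and F' are the loads at the beginning and at the end of the time step. *)
Definition etd_step (R : realType) (s : etd_scheme) (dt : R) n (A : 'M[R]_n)
    (u F F' : 'cV[R]_n) : 'cV[R]_n :=
  match s with
  | ETD1 => expmx (dt *: A) *m u + Phi dt A *m F'
  | ETD2 => expmx (dt *: A) *m u + Phi dt A *m F + Psi dt A *m (F' - F)
  end.

Record ddproblem (R : realType) := DDProblem {
  nu : R;
  len : R;                (* L *)
  final_time : R;         (* T *)
  source : R -> R -> R;   (* f(x, t) *)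
  bc_left : R -> R;       (* psi_1 *)
  bc_right : R -> R;      (* psi_2 *)
  u_init : R -> R;        (* u_0 *)
  Nx : nat;               (* N *)
  Mt : nat;               (* M *)
  Nalpha : nat;
  Nbeta : nat
}.

Section Schemes.
Context {R : realType} (P : ddproblem R).

Definition mesh : R := len P / (Nx P).+1%:R.
Definition tstep : R := final_time P / (Mt P)%:R.
Definition tgrid (m : nat) : R := m%:R * tstep.

Definition N1 : nat := (Nbeta P - 1)%N.
Definition N2 : nat := (Nx P - Nalpha P)%N.
Definition Nba : nat := (Nbeta P - Nalpha P)%N.

Definition A1 : 'M[R]_N1 := laplacian_mx (nu P) mesh N1.
Definition A2 : 'M[R]_N2 := laplacian_mx (nu P) mesh N2.

Definition u1_init : 'cV[R]_N1 := \col_(i < N1) u_init P (i.+1%:R * mesh).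
Definition u2_init : 'cV[R]_N2 :=
  \col_(i < N2) u_init P ((i.+1 + Nalpha P)%N%:R * mesh).

(* Given the sequence w2 of interface values at x = beta L (resp. w1 at
   x = alpha L), the load of the left (resp. right) subdomain at time t_m. *)
Definition F1 (w2 : nat -> R) (m : nat) : 'cV[R]_N1 :=
  load_vec (nu P) mesh N1 (fun j => source P (j%:R * mesh) (tgrid m))
    (bc_left P (tgrid m)) (w2 m).
Definition F2 (w1 : nat -> R) (m : nat) : 'cV[R]_N2 :=
  load_vec (nu P) mesh N2
    (fun j => source P ((Nalpha P + j)%N%:R * mesh) (tgrid m))
    (w1 m) (bc_right P (tgrid m)).

(* Only the values u1 m and u2 m for 0 <= m <= M are constrained. *)
Definition is_localized_etd (s : etd_scheme)
    (u1 : nat -> 'cV[R]_N1) (u2 : nat -> 'cV[R]_N2) : Prop :=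
  let w1 m := entry (u1 m) (Nalpha P) in
  let w2 m := entry (u2 m) Nba in
  [/\ u1 0%N = u1_init,
      u2 0%N = u2_init &
      forall m, (m < Mt P)%N ->
        u1 m.+1 = etd_step s tstep A1 (u1 m) (F1 w2 m) (F1 w2 m.+1) /\
        u2 m.+1 = etd_step s tstep A2 (u2 m) (F2 w1 m) (F2 w1 m.+1)].

(* Interface values of the k-th iterate: the prescribed value c at m = 0 for
   every k, the initial guess g when k = 0 and m >= 1, and the j-th component
   of the iterate otherwise. *)
Definition interface n (c : R) (g : nat -> R) (uk : nat -> nat -> 'cV[R]_n)
    (j k m : nat) : R :=
  if m == 0%N then c else if k == 0%N then g m else entry (uk k m) j.

(* u1k k m is the k-th iterate at time t_m, k >= 1; the vectors u1k 0 m and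
   u2k 0 m are not used, since only interface values are given at k = 0. *)
Definition is_method2 (s : etd_scheme) (g1 g2 : nat -> R)
    (u1k : nat -> nat -> 'cV[R]_N1) (u2k : nat -> nat -> 'cV[R]_N2) : Prop :=
  let w1 := interface (u_init P ((Nalpha P)%:R * mesh)) g1 u1k (Nalpha P) in
  let w2 := interface (u_init P ((Nbeta P)%:R * mesh)) g2 u2k Nba in
  (forall k, u1k k.+1 0%N = u1_init /\ u2k k.+1 0%N = u2_init) /\
  (forall k m, (m < Mt P)%N ->
     u1k k.+1 m.+1 =
       etd_step s tstep A1 (u1k k.+1 m) (F1 (w2 k) m) (F1 (w2 k) m.+1) /\
     u2k k.+1 m.+1 =
       etd_step s tstep A2 (u2k k.+1 m) (F2 (w1 k) m) (F2 (w1 k) m.+1)).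

End Schemes.

Definition kappa (R : realType) (alpha beta : R) : R :=
  (alpha * (1 - beta)) / (beta * (1 - alpha)).

(* Main.v *)
Require Import Defs.
From HB Require Import structures.
From mathcomp Require Import all_boot all_order all_algebra.
From mathcomp Require Import all_classical all_reals all_analysis.
From mathcomp Require Import ring lra zify.

Set Implicit Arguments.
Unset Strict Implicit.
Unset Printing Implicit Defensive.

Import Order.TTheory GRing.Theory Num.Theory.
Import numFieldNormedType.Exports.

Local Open Scope classical_set_scope.
Local Open Scope ring_scope.

(** The error of an iterate satisfies the homogeneous scheme: zero source, zero
initial value, zero physical boundary value, and as its only datum the error
[eps m] of the interface value taken from the other subdomain.  Hence, if [b] is
the load of a unit interface value, the error obeys
[e m.+1 = etd_step (e m) (eps m *: b) (eps m.+1 *: b)].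

Let [s] be the discrete steady state of a unit interface value, [A *m s = - b].
As the second difference of an affine grid function vanishes, [s] is affine: it
decreases linearly from 1 at the interface to 0 at the physical boundary.  The
error bound is the comparison principle [|e m| <= d *: s] whenever [|eps| <= d]
([le_etd_step], [le_etd_trajectory]).  It holds because [s] is a fixed point of
the scheme with constant load [b], and because the scheme is monotone in the
state and in the two loads: [expmx (dt *: A)] is entrywise nonnegative, and
[Phi b - Psi b] and [Psi b], the weights of the two loads in ETD2, are
nonnegative vectors.

Nonnegativity of the exponential comes from writing [A = B - c I] with [B >= 0],
so that exp(tA) = exp(-ct) exp(tB), the last series having nonnegative terms.
For the weights, put p(t) = s - exp(tA) s and
q(t) = t s - A^-1 (exp(tA) - 1) s; then [Phi b] = p(dt) and [Psi b] = q(dt)/dt,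
while p' = exp(tA) b >= 0, q' = p and (t p - q)' = t p'.  As p, q and
t p - q vanish at 0, it follows that 0 <= q <= t p for t >= 0.

Reading the bound at the grid point that feeds the other subdomain, one
iteration multiplies the interface error by s there, that is by alpha / beta from
the left subdomain and by (1 - beta) / (1 - alpha) from the right one.  Both
factors are below 1, which gives convergence; their product is kappa, gained
every second iteration ([alternating_contraction]). *)

(** * Entrywise derivatives of matrix functions *)

Section MatrixDerivative.
Context {R : realType}.

Definition mx_is_derive m n (Y : R -> 'M[R]_(m, n)) (t : R) (D : 'M[R]_(m, n)) :=
  forall i j, is_derive t (1 : R) (fun x => Y x i j) (D i j).

Lemma mx_is_derive_eq m n (Y : R -> 'M[R]_(m, n)) t (D D' : 'M[R]_(m, n)) :
  mx_is_derive Y t D -> D = D' -> mx_is_derive Y t D'.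
Proof. by move=> dY <-. Qed.

Lemma mx_is_derive_cst m n (C : 'M[R]_(m, n)) t : mx_is_derive (fun=> C) t 0.
Proof. by move=> i j; rewrite mxE; exact: is_derive_cst. Qed.

Lemma mx_is_deriveN m n (Y : R -> 'M[R]_(m, n)) t D :
  mx_is_derive Y t D -> mx_is_derive (fun x => - Y x) t (- D).
Proof.
move=> dY i j; rewrite mxE.
under eq_fun do rewrite mxE.
exact: is_deriveN.
Qed.

Lemma mx_is_deriveD m n (Y Z : R -> 'M[R]_(m, n)) t D D' :
  mx_is_derive Y t D -> mx_is_derive Z t D' ->
  mx_is_derive (fun x => Y x + Z x) t (D + D').
Proof.
move=> dY dZ i j; rewrite mxE.
under eq_fun do rewrite mxE.
exact: is_deriveD.
Qed.

Lemma mx_is_deriveZ m n (a : R -> R) (Y : R -> 'M[R]_(m, n)) t a' D :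
  is_derive t (1 : R) a a' -> mx_is_derive Y t D ->
  mx_is_derive (fun x => a x *: Y x) t (a t *: D + a' *: Y t).
Proof.
move=> da dY i j; rewrite !mxE.
under eq_fun do rewrite mxE.
have H := is_deriveM da (dY i j).
by apply: is_derive_eq H _; rewrite /GRing.scale /= [Y t i j * _]mulrC.
Qed.

Lemma mx_is_deriveM m n p (Y : R -> 'M[R]_(m, n)) (Z : R -> 'M[R]_(n, p))
    t D D' :
  mx_is_derive Y t D -> mx_is_derive Z t D' ->
  mx_is_derive (fun x => Y x *m Z x) t (Y t *m D' + D *m Z t).
Proof.
move=> dY dZ i j; rewrite !mxE -big_split /=.
have -> : (fun x => (Y x *m Z x) i j) =
    \sum_k ((fun x => Y x i k) * (fun x => Z x k j)).
  by apply/funext => x; rewrite mxE fct_sumE.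
apply: is_derive_sum => k.
have H := is_deriveM (dY i k) (dZ k j).
by apply: is_derive_eq H _; rewrite /GRing.scale /= [Z t k j * _]mulrC.
Qed.

Lemma mx_is_derive_0_is_cst m n (Y : R -> 'M[R]_(m, n)) s t :
  (forall x, mx_is_derive Y x 0) -> Y s = Y t.
Proof.
move=> dY; apply/matrixP => i j.
apply: (@is_derive_0_is_cst R (fun x => Y x i j)) => x.
by have := dY x i j; rewrite mxE.
Qed.

Lemma mx_derive_ge0_le m n (Y D : R -> 'M[R]_(m, n)) t :
  0 <= t -> (forall x, mx_is_derive Y x (D x)) ->
  (forall x i j, 0 <= x -> x <= t -> 0 <= D x i j) ->
  forall i j, Y 0 i j <= Y t i j.
Proof.
move=> t_ge0 dY D_ge0 i j.
have [x _|x|x /[!in_itv]/= /andP[x0 xt]] :=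
    @MVT_segment R (fun x => Y x i j) (fun x => D x i j) 0 t t_ge0.
- exact: dY.
- apply: continuous_subspaceT => y.
  apply/differentiable_continuous/derivable1_diffP.
  by have [] := dY y i j.
- by move=> /eqP; rewrite -subr_ge0 => /eqP ->; rewrite subr0 mulr_ge0 ?D_ge0.
Qed.

End MatrixDerivative.

(** * The matrix exponential and its differential equation *)

Section MatrixExponential.
Context {R : realType}.

Lemma cvg_mx_entrywise m n (u : nat -> 'M[R]_(m, n)) (l : 'M[R]_(m, n)) :
  (forall i j, (fun k => u k i j) @ \oo --> l i j) -> u @ \oo --> l.
Proof.
move=> ul; apply/cvg_ballP => e e_gt0.
have H : \forall k \near \oo, forall ij : 'I_m * 'I_n,
    ball (l ij.1 ij.2) e (u k ij.1 ij.2).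
  apply: filter_forall => -[i j] /=.
  by have /cvg_ballP/(_ e e_gt0) := ul i j.
by apply: filterS H => k H; split => // i j; exact: (H (i, j)).
Qed.

(** The coefficients in t of the entries of C exp(tA).  The factor C makes the
family stable under differentiation: deriving turns C into C A. *)
Definition expmx_coeff m n (C : 'M[R]_(m, n)) (A : 'M[R]_n) i j (k : nat) : R :=
  (C *m A ^+ k) i j / k`!%:R.

Lemma diffs_expmx_coeff m n (C : 'M[R]_(m, n)) A i j :
  pseries_diffs (expmx_coeff C A i j) = expmx_coeff (C *m A) A i j.
Proof.
apply/funext => k; rewrite /pseries_diffs /expmx_coeff.
by rewrite exprS mulmxA factS natrM invfM mulrCA mulVKf.
Qed.

Lemma mulmx_exp_geometric m n (C : 'M[R]_(m, n)) (A : 'M[R]_n) :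
  exists c K : R,
    [/\ 0 <= c, 0 <= K & forall k i j, `|(C *m A ^+ k) i j| <= c * K ^+ k].
Proof.
pose l1 p q (B : 'M[R]_(p, q)) := \sum_i \sum_j `|B i j|.
have le_l1 p q (B : 'M[R]_(p, q)) i j : `|B i j| <= l1 _ _ B.
  rewrite /l1 (bigD1 i) //= (bigD1 j) //= -addrA lerDl.
  by rewrite addr_ge0 ?sumr_ge0// => a _; rewrite sumr_ge0.
have l1_ge0 p q (B : 'M[R]_(p, q)) : 0 <= l1 _ _ B.
  by rewrite sumr_ge0// => a _; rewrite sumr_ge0.
exists (l1 _ _ C), (n%:R * l1 _ _ A); split => //; first by rewrite mulr_ge0.
elim => [|k IH] i j; first by rewrite !expr0 mulmx1 mulr1.
rewrite exprSr mulmxA mxE (le_trans (ler_norm_sum _ _ _))//.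
have -> : l1 _ _ C * (n%:R * l1 _ _ A) ^+ k.+1 =
    \sum_(l < n) (l1 _ _ C * (n%:R * l1 _ _ A) ^+ k * l1 _ _ A).
  by rewrite sumr_const card_ord exprSr -mulr_natl; ring.
by apply: ler_sum => l _; rewrite normrM ler_pM// IH.
Qed.

(** Domination by the series of the scalar exponential. *)
Lemma cvg_expmx_series m n (C : 'M[R]_(m, n)) (A : 'M[R]_n) i j t :
  cvgn (pseries (expmx_coeff C A i j) t).
Proof.
have [c [K [c0 K0 CK]]] := mulmx_exp_geometric C A.
apply: normed_cvg.
apply: (@series_le_cvg _ _ (c *: exp_coeff (K * `|t|))) => [k|k|k|].
- exact: normr_ge0.
- by rewrite mulr_ge0// exp_coeff_ge0// mulr_ge0.
- rewrite /expmx_coeff /exp_coeff /= 2!normrM normrX normfV.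
  rewrite (@ger0_norm _ k`!%:R)// [leRHS]mulrA exprMn mulrA mulrAC.
  by rewrite ler_wpM2r ?invr_ge0// ler_wpM2r// exprn_ge0.
- by apply: is_cvg_seriesZ; exact: is_cvg_series_exp_coeff.
Qed.


Lemma cvg_mx_entry m n (u : nat -> 'M[R]_(m, n)) (l : 'M[R]_(m, n)) i j :
  u @ \oo --> l -> (fun k => u k i j) @ \oo --> l i j.
Proof.
move=> ul.
apply: (cvg_comp u (fun M : 'M[R]_(m, n) => M i j) ul).
exact: coord_continuous.
Qed.

Arguments cvg_mx_entry {m n u l} i j.

Lemma cvg_mulmxl m n p (C : 'M[R]_(m, n)) (u : nat -> 'M[R]_(n, p))
    (l : 'M[R]_(n, p)) :
  u @ \oo --> l -> (fun k => C *m u k) @ \oo --> C *m l.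
Proof.
move=> ul; apply: cvg_mx_entrywise => i j; rewrite mxE.
under eq_fun do rewrite mxE.
apply: cvg_big => [|k _]; first exact: add_continuous.
apply: cvgMl_tmp.
exact: cvg_mx_entry.
Qed.

Lemma cvg_mulmxr m n p (C : 'M[R]_(n, p)) (u : nat -> 'M[R]_(m, n))
    (l : 'M[R]_(m, n)) :
  u @ \oo --> l -> (fun k => u k *m C) @ \oo --> l *m C.
Proof.
move=> ul; apply: cvg_mx_entrywise => i j; rewrite mxE.
under eq_fun do rewrite mxE.
apply: cvg_big => [|k _]; first exact: add_continuous.
apply: cvgMr_tmp.
exact: cvg_mx_entry.
Qed.

Arguments cvg_mulmxl {m n p} C {u l}.
Arguments cvg_mulmxr {m n p} C {u l}.

Lemma cvg_expmx n (A : 'M[R]_n) :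
  series (fun k => (k`!%:R)^-1 *: A ^+ k) @ \oo --> expmx A.
Proof.
pose l := \matrix_(i, j) limn (pseries (expmx_coeff 1%:M A i j) 1).
suff H : series (fun k => (k`!%:R)^-1 *: A ^+ k) @ \oo --> l.
  by rewrite /expmx (cvg_lim _ H)//; exact: norm_hausdorff.
apply: cvg_mx_entrywise => i j; rewrite mxE.
have -> : (fun k => series (fun k => (k`!%:R)^-1 *: A ^+ k) k i j) =
    pseries (expmx_coeff 1%:M A i j) 1.
  apply/funext => k; rewrite /series /= summxE; apply: eq_bigr => r _.
  by rewrite /expmx_coeff /= mul1mx expr1n !mxE mulr1 mulrC.
exact: cvg_expmx_series.
Qed.

Arguments cvg_expmx {n} A.

Lemma exprZmx n (A : 'M[R]_n) t k : (t *: A) ^+ k = t ^+ k *: A ^+ k.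
Proof.
elim: k => [|k IH]; first by rewrite !expr0 scale1r.
by rewrite !exprS IH -!mulmxE -scalemxAl -scalemxAr scalerA.
Qed.

Lemma lim_expmx_series m n (C : 'M[R]_(m, n)) (A : 'M[R]_n) i j t :
  limn (pseries (expmx_coeff C A i j) t) = (C *m expmx (t *: A)) i j.
Proof.
apply: cvg_lim => //.
suff -> : pseries (expmx_coeff C A i j) t = fun k =>
    (C *m series (fun k => (k`!%:R)^-1 *: (t *: A) ^+ k) k) i j.
  exact: cvg_mx_entry (cvg_mulmxl C (cvg_expmx (t *: A))).
apply/funext => k.
rewrite /pseries /series /= mulmx_sumr summxE; apply: eq_bigr => r _.
by rewrite /expmx_coeff /= exprZmx -!scalemxAr !mxE; ring.
Qed.

Lemma expmx_comm n (A : 'M[R]_n) : expmx A *m A = A *m expmx A.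
Proof.
apply: (cvg_unique _ (cvg_mulmxr A (cvg_expmx A))).
  exact: norm_hausdorff.
suff -> : (fun k => series (fun k => (k`!%:R)^-1 *: A ^+ k) k *m A) =
    fun k => A *m series (fun k => (k`!%:R)^-1 *: A ^+ k) k.
  exact: cvg_mulmxl (cvg_expmx A).
apply/funext => k.
rewrite /series /= mulmx_sumr mulmx_suml; apply: eq_bigr => r _.
by rewrite -scalemxAl -scalemxAr !mulmxE -exprS -exprSr.
Qed.

Lemma expmx0 n : expmx (0 : 'M[R]_n) = 1%:M.
Proof.
rewrite /expmx; apply: lim_near_cst; first exact: norm_hausdorff.
near=> k; rewrite -(@prednK k); last by near: k; exact: nbhs_infty_gt.
rewrite /series /= big_nat_recl//= big1 ?addr0 ?expr0 ?fact0 ?invr1 ?scale1r//.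
by move=> r _; rewrite exprS mul0r scaler0.
Unshelve. all: by end_near. Qed.

Lemma is_derive_expmx n (A : 'M[R]_n) t :
  mx_is_derive (fun x => expmx (x *: A)) t (A *m expmx (t *: A)).
Proof.
move=> i j.
have -> : (fun x => expmx (x *: A) i j) =
    fun x => limn (pseries (expmx_coeff 1%:M A i j) x).
  by apply/funext => x; rewrite lim_expmx_series mul1mx.
have -> : (A *m expmx (t *: A)) i j =
    limn (pseries (pseries_diffs (expmx_coeff 1%:M A i j)) t).
  by rewrite diffs_expmx_coeff lim_expmx_series mul1mx.
apply: (@pseries_snd_diffs _ _ (`|t| + 1)).
- exact: cvg_expmx_series.
- by rewrite diffs_expmx_coeff; exact: cvg_expmx_series.
- by rewrite !diffs_expmx_coeff; exact: cvg_expmx_series.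
- by rewrite [ltRHS]ger0_norm ?addr_ge0// ltrDl.
Qed.

(** Both Y(t) and exp(tA) are left-inverted by exp(-tA): the product has zero
derivative and is the identity at t = 0. *)
Lemma mx_ode_unique n (A : 'M[R]_n) (Y : R -> 'M[R]_n) :
  Y 0 = 1%:M -> (forall t, mx_is_derive Y t (A *m Y t)) ->
  forall t, Y t = expmx (t *: A).
Proof.
move=> Y0 dY t.
have inv (Z : R -> 'M[R]_n) : Z 0 = 1%:M ->
    (forall t, mx_is_derive Z t (A *m Z t)) ->
    expmx (t *: - A) *m Z t = 1%:M.
  move=> Z0 dZ.
  rewrite (@mx_is_derive_0_is_cst _ _ _
    (fun t => expmx (t *: - A) *m Z t) t 0).
    by rewrite scale0r expmx0 Z0 mulmx1.
  move=> x.
  apply: mx_is_derive_eq (mx_is_deriveM (is_derive_expmx (- A) x) (dZ x)) _.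
  have [->|x0] := eqVneq x 0.
    by rewrite scale0r expmx0 mulmx1 mul1mx -mulmxDl subrr mul0mx.
  have : expmx (x *: - A) *m (x *: - A) = (x *: - A) *m expmx (x *: - A).
    exact: expmx_comm.
  rewrite -scalemxAl -scalemxAr => /(scalerI x0) <-.
  by rewrite mulmxN mulNmx mulmxA subrr.
have NY := inv Y Y0 dY.
have NE : expmx (t *: - A) *m expmx (t *: A) = 1%:M.
  apply: (inv (fun t => expmx (t *: A))) => [|x].
    by rewrite scale0r expmx0.
  exact: is_derive_expmx.
by rewrite -[Y t]mul1mx -(mulmx1C NE) -mulmxA NY mulmx1.
Qed.

Lemma expmx_ge0 n (B : 'M[R]_n) i j :
  (forall i j, 0 <= B i j) -> 0 <= expmx B i j.
Proof.
move=> B_ge0.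
have Bk_ge0 k : forall i j, 0 <= (B ^+ k) i j.
  elim: k => [|k IH] a b; first by rewrite expr0 mxE; case: eqP.
  by rewrite exprS mxE sumr_ge0// => r _; rewrite mulr_ge0.
have -> : expmx B i j = limn (pseries (expmx_coeff 1%:M B i j) 1).
  by rewrite lim_expmx_series mul1mx scale1r.
apply: limr_ge; first exact: cvg_expmx_series.
near=> k; apply: sumr_ge0 => r _; rewrite /= expr1n mulr1.
by rewrite /expmx_coeff mul1mx mulr_ge0 ?invr_ge0.
Unshelve. all: by end_near. Qed.

(** A matrix with nonnegative off-diagonal entries (a Metzler matrix) becomes
nonnegative once a large multiple c of the identity is added; this multiplies
its exponential by the positive scalar exp(ct). *)
Lemma expmx_metzler_ge0 n (A : 'M[R]_n) (t : R) :
  (forall i j, i != j -> 0 <= A i j) -> 0 <= t ->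
  forall i j, 0 <= expmx (t *: A) i j.
Proof.
move=> A_ge0 t_ge0 i j.
pose c : R := \sum_i `|A i i|; pose B := A + c%:M.
have B_ge0 a b : 0 <= B a b.
  rewrite !mxE; have [->|ab] := eqVneq a b; last by rewrite addr0 A_ge0.
  rewrite mulr1n addrC -[A b b]opprK subr_ge0 (le_trans (ler_norm _))// normrN.
  by rewrite /c (bigD1 b)//= lerDl sumr_ge0.
have <- : expR (- c * t) *: expmx (t *: B) = expmx (t *: A).
  apply: (@mx_ode_unique _ A
    (fun t => expR (- c * t) *: expmx (t *: B))) => [|x].
    by rewrite mulr0 expR0 !scale0r scale1r expmx0.
  have dexp : is_derive x 1 (fun x => expR (- c * x)) (- c * expR (- c * x)).
    have dlin : is_derive x 1 (fun x : R => - c * x) (- c).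
      apply: is_derive_eq (is_deriveZ (- c) (is_derive_id x (1 : R))) _.
      by rewrite /GRing.scale /= mulr1.
    by have := is_derive1_comp (is_derive_expR (- c * x)) dlin; rewrite mulrC.
  apply: mx_is_derive_eq (mx_is_deriveZ dexp (is_derive_expmx B x)) _.
  rewrite -scalemxAr mulmxDl scalerDr mul_scalar_mx scalerA -addrA -scalerDl.
  by rewrite (_ : _ * c + _ = 0) ?scale0r ?addr0//; ring.
rewrite mxE mulr_ge0 ?expR_ge0// expmx_ge0// => a b.
by rewrite mxE mulr_ge0.
Qed.

End MatrixExponential.

(** * Comparison of the error with the steady state *)

Section EtdBarrier.
Context {R : realType} (n : nat) (A : 'M[R]_n) (b s : 'cV[R]_n).
Context (A_unit : A \in unitmx).
Context (A_metzler : forall i j, i != j -> 0 <= A i j).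
Context (b_ge0 : forall i, 0 <= b i 0).
Context (steady : A *m s = - b).

Let E (t : R) := expmx (t *: A).

Let E_comm t : E t *m A = A *m E t.
Proof.
have [->|t0] := eqVneq t 0; first by rewrite /E scale0r expmx0 mulmx1 mul1mx.
have := expmx_comm (t *: A).
by rewrite -scalemxAl -scalemxAr => /(scalerI t0).
Qed.

Let invA_E_A t (v : 'cV[R]_n) : invmx A *m (E t *m (A *m v)) = E t *m v.
Proof. by rewrite [E t *m _]mulmxA E_comm -[_ *m v]mulmxA mulKmx. Qed.

(** By this identity [s] is a fixed point of the step with constant load [b]. *)
Lemma mul_Phi_load t : Phi t A *m b = s - E t *m s.
Proof.
rewrite -[b]opprK -steady /Phi -/(E t) -mulmxA mulmxN mulmxBl mul1mx.
by rewrite mulmxN mulmxBr invA_E_A mulKmx// opprB.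
Qed.

Lemma mul_Psi_load (t : R) : t != 0 ->
  Psi t A *m b = t^-1 *: (t *: s - invmx A *m ((E t - 1%:M) *m s)).
Proof.
move=> t0; rewrite -[b]opprK -steady /Psi -/(E t) -scalemxAl; congr (_ *: _).
rewrite -!mulmxA mulmxN !mulmxN.
rewrite !mulmxBl mul1mx !mulmxBr invA_E_A mulKmx// -!scalemxAl -!scalemxAr.
by rewrite !mul1mx !(mulKmx A_unit) opprB.
Qed.

Let load_E_ge0 (t : R) : 0 <= t -> forall i j, 0 <= (E t *m b) i j.
Proof.
move=> t0 i j; rewrite mxE sumr_ge0// => k _.
by rewrite ord1 mulr_ge0//; exact: expmx_metzler_ge0.
Qed.

Let is_derive_p t : mx_is_derive (fun t => s - E t *m s) t (E t *m b).
Proof.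
apply: mx_is_derive_eq (mx_is_deriveD (mx_is_derive_cst s t)
  (mx_is_deriveN
    (mx_is_deriveM (is_derive_expmx A t) (mx_is_derive_cst s t)))) _.
by rewrite mulmx0 !add0r -/(E t) -E_comm -mulmxA steady mulmxN opprK.
Qed.

Let is_derive_q t :
  mx_is_derive (fun t => t *: s - invmx A *m ((E t - 1%:M) *m s)) t
    (s - E t *m s).
Proof.
have dF := mx_is_deriveD (is_derive_expmx A t)
  (mx_is_deriveN (mx_is_derive_cst 1%:M t)).
have dG := mx_is_deriveM (mx_is_derive_cst (invmx A) t)
  (mx_is_deriveM dF (mx_is_derive_cst s t)).
apply: mx_is_derive_eq (mx_is_deriveD
  (mx_is_deriveZ (is_derive_id t (1 : R)) (mx_is_derive_cst s t))
  (mx_is_deriveN dG)) _.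
rewrite scaler0 add0r scale1r mul0mx addr0 mulmx0 add0r oppr0 addr0.
by rewrite -mulmxA mulKmx.
Qed.

Lemma mul_Phi_load_ge0 (t : R) : 0 <= t -> forall i, 0 <= (Phi t A *m b) i 0.
Proof.
move=> t0 i; rewrite mul_Phi_load.
have p_homo :=
  mx_derive_ge0_le t0 is_derive_p (fun x i j x0 _ => load_E_ge0 x0 i j).
apply: le_trans (p_homo i 0).
by rewrite /E scale0r expmx0 mul1mx subrr mxE.
Qed.

(** [Psi t A *m b] is the mean over [0, t] of [Phi x A *m b]. *)
Lemma mul_Psi_load_ge0 (t : R) : 0 < t -> forall i, 0 <= (Psi t A *m b) i 0.
Proof.
move=> t0 i; rewrite mul_Psi_load ?gt_eqF// mxE mulr_ge0 ?invr_ge0 ?(ltW t0)//.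
have Dge0 x j k : 0 <= x -> x <= t -> 0 <= (s - E x *m s) j k.
  by move=> x0 _; rewrite -mul_Phi_load (ord1 k); exact: mul_Phi_load_ge0.
apply: le_trans (mx_derive_ge0_le (ltW t0) is_derive_q Dge0 i 0).
by rewrite /E !scale0r expmx0 subrr mul0mx mulmx0 subrr mxE.
Qed.

(** [Phi x A *m b] increases with x, so its mean over [0, t] is at most its value
at t. *)
Lemma mul_Psi_load_le (t : R) : 0 < t ->
  forall i, (Psi t A *m b) i 0 <= (Phi t A *m b) i 0.
Proof.
move=> t0 i; rewrite mul_Psi_load ?gt_eqF// mul_Phi_load mxE ler_pdivrMl//.
(* r is t p(t) - q(t), with derivative t p'(t) *)
pose r x := x *: (s - E x *m s) - (x *: s - invmx A *m ((E x - 1%:M) *m s)).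
have dr x : mx_is_derive r x (x *: (E x *m b)).
  apply: mx_is_derive_eq (mx_is_deriveD
    (mx_is_deriveZ (is_derive_id x (1 : R)) (is_derive_p x))
    (mx_is_deriveN (is_derive_q x))) _.
  by rewrite scale1r addrK.
have dr_ge0 x j k : 0 <= x -> x <= t -> 0 <= (x *: (E x *m b)) j k.
  by move=> x0 _; rewrite mxE mulr_ge0 ?load_E_ge0.
have := mx_derive_ge0_le (ltW t0) dr dr_ge0 i 0.
have -> : r 0 = 0.
  by rewrite /r /E !scale0r expmx0 subrr mul0mx mulmx0 !subrr.
rewrite [X in X <= _]mxE /r [X in _ <= X]mxE [X in _ + X]mxE subr_ge0.
by rewrite [X in _ <= X]mxE.
Qed.

(** In both schemes the new state is exp(dt A) x plus a combination, with
nonnegative vector coefficients summing to [Phi dt A *m b], of the scalar data;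
taking absolute values replaces x by d s and the data by d, and d s is then
reproduced by the step. *)
Lemma le_etd_step (sch : etd_scheme) dt (x : 'cV[R]_n) (d e e' : R) :
  0 < dt -> (forall i, `|x i 0| <= d * s i 0) -> `|e| <= d -> `|e'| <= d ->
  forall i, `|etd_step sch dt A x (e *: b) (e' *: b) i 0| <= d * s i 0.
Proof.
move=> dt0 xs ed e'd i.
have Ex : `|(E dt *m x) i 0| <= d * (E dt *m s) i 0.
  rewrite !mxE mulr_sumr (le_trans (ler_norm_sum _ _ _))//; apply: ler_sum => k _.
  have E_ge0 : 0 <= E dt i k by apply: expmx_metzler_ge0 => //; exact: ltW.
  by rewrite normrM ger0_norm// mulrCA ler_wpM2l.
have sE : s i 0 = (E dt *m s) i 0 + (Phi dt A *m b) i 0.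
  by rewrite mul_Phi_load [X in _ + X]mxE [X in _ + (_ + X)]mxE addrC subrK.
have phi0 := mul_Phi_load_ge0 (ltW dt0) i.
have psi0 := mul_Psi_load_ge0 dt0 i.
have psile := mul_Psi_load_le dt0 i.
rewrite sE mulrDr; case: sch => /=.
  rewrite -scalemxAr mxE (le_trans (ler_normD _ _))// lerD// mxE normrM.
  by rewrite (ger0_norm phi0) ler_wpM2r.
rewrite -scalerBl -!scalemxAr -addrA mxE (le_trans (ler_normD _ _))// lerD//.
rewrite mxE [X in `|X + _|]mxE [X in `|_ + X|]mxE.
move: phi0 psi0 psile.
set phi := (Phi _ _ *m b) i 0; set psi := (Psi _ _ *m b) i 0.
move=> phi0 psi0 psile.
(* ETD2 weighs the initial load by phi - psi and the final one by psi *)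
have -> : e * phi + (e' - e) * psi = e * (phi - psi) + e' * psi by ring.
have -> : d * phi = d * (phi - psi) + d * psi by ring.
rewrite (le_trans (ler_normD _ _))// !normrM (ger0_norm psi0).
rewrite (@ger0_norm _ (phi - psi)) ?subr_ge0//.
by rewrite lerD// ler_wpM2r// subr_ge0.
Qed.

End EtdBarrier.

Section Trajectory.
Context {R : realType} (n : nat).

Lemma etd_stepB sch dt (A : 'M[R]_n) u v F G F' G' :
  etd_step sch dt A u F F' - etd_step sch dt A v G G' =
  etd_step sch dt A (u - v) (F - G) (F' - G').
Proof.
case: sch => /=; first by rewrite !mulmxBr opprD addrACA.
rewrite opprD addrACA; congr (_ + _); first by rewrite opprD addrACA -!mulmxBr.
rewrite -mulmxBr; congr (_ *m _).
by rewrite !opprB addrACA [RHS]addrACA (addrC (- F)).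
Qed.

Lemma le_etd_trajectory (A : 'M[R]_n) (b s : 'cV[R]_n) sch (dt : R) M
    (e : nat -> 'cV[R]_n) (eps : nat -> R) (d : R) :
  A \in unitmx -> (forall i j, i != j -> 0 <= A i j) ->
  (forall i, 0 <= b i 0) -> (forall i, 0 <= s i 0) -> A *m s = - b ->
  0 < dt -> e 0%N = 0 ->
  (forall m, (m < M)%N ->
    e m.+1 = etd_step sch dt A (e m) (eps m *: b) (eps m.+1 *: b)) ->
  (forall m, (m <= M)%N -> `|eps m| <= d) ->
  forall m i, (m <= M)%N -> `|e m i 0| <= d * s i 0.
Proof.
move=> A_unit A_metzler b_ge0 s_ge0 steady dt0 e0 eS eps_d.
have d_ge0 : 0 <= d by rewrite (le_trans _ (eps_d 0%N _)).
elim => [|m IH] i mM; first by rewrite e0 mxE normr0 mulr_ge0.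
rewrite eS//; apply: le_etd_step => //.
- by move=> j; rewrite IH// ltnW.
- by rewrite eps_d// ltnW.
- by rewrite eps_d.
Qed.

End Trajectory.

(** * The discrete Laplacian and its affine steady states *)

Section Laplacian.
Context {R : realType}.
Implicit Types (nu h : R) (n : nat).

Lemma entryE n (v : 'cV[R]_n) j (jn : (j < n)%N) :
  entry v j.+1 = v (Ordinal jn) 0.
Proof. by rewrite /entry insubT. Qed.

Lemma entry_ord n (v : 'cV[R]_n) (i : 'I_n) : entry v i.+1 = v i 0.
Proof. by rewrite (entryE v (ltn_ord i)); congr (v _ _); exact: val_inj. Qed.

Lemma entry_out n (v : 'cV[R]_n) j : (n < j)%N -> entry v j = 0.
Proof. by case: j => // j nj; rewrite /entry insubF// ltnNge -ltnS nj. Qed.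

Lemma entryB n (u v : 'cV[R]_n) j : entry (u - v) j = entry u j - entry v j.
Proof.
case: j => [|j]; first by rewrite subr0.
by rewrite /entry; case: insubP => [i _ _|_]; rewrite ?mxE ?subr0.
Qed.

(** Keeping the truncation of the stencil in the first and last rows explicit
lets the same formula serve for vectors extended by zero and for affine ones. *)
Lemma mul_laplacian_mx nu h n (w : nat -> R) (i : 'I_n) :
  (laplacian_mx nu h n *m \col_j w j.+1) i 0 =
  nu / h ^+ 2 * ((if i == 0%N :> nat then 0 else w i) - 2 * w i.+1
                 + (if i.+1 == n then 0 else w i.+2)).
Proof.
rewrite -scalemxAl mxE mxE; congr (_ * _).
rewrite (eq_bigr (fun k : 'I_n =>
   (if (k : nat) == i.-1 then (if i == 0%N :> nat then 0 else w k.+1) else 0)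
   + (if (k : nat) == i then - 2 * w k.+1 else 0)
   + (if (k : nat) == i.+1 then w k.+1 else 0))); last first.
  move=> k _; rewrite !mxE -val_eqE /=.
  case: i k => [i ilt] [k klt] /=; case: (ltngtP i k) => [ik|ki|->] /=.
  - have -> : (k == i.-1) = false by lia.
    have -> : (k.+1 == i) = false by lia.
    rewrite orbF eq_sym !add0r.
    by case: eqP; rewrite (mul1r, mul0r).
  - have -> : (i.+1 == k) = false by lia.
    have -> : (k == i.+1) = false by lia.
    have -> : (i == 0%N) = false by lia.
    have -> : (k == i.-1) = (k.+1 == i) by lia.
    by rewrite /= !addr0; case: eqP; rewrite (mul1r, mul0r).
  - have -> : (k == k.+1) = false by lia.
    rewrite addr0; case: k {klt} => [|k]; first by rewrite /= add0r.
    have -> : (k.+1 == k) = false by lia.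
    by rewrite add0r.
have sum_at (j : nat) (F : nat -> R) :
    \sum_(k < n) (if k == j :> nat then F k else 0) =
    if (j < n)%N then F j else 0.
  by rewrite -big_mkcond big_ord1_eq.
rewrite !big_split /=.
rewrite (sum_at i.-1 (fun k => if i == 0%N :> nat then 0 else w k.+1)).
rewrite (sum_at i (fun k => - 2 * w k.+1)) (sum_at i.+1 (fun k => w k.+1)).
rewrite (ltn_ord i) mulNr (leq_ltn_trans (leq_pred i) (ltn_ord i)).
congr (_ - _ + _).
  by case: eqP => // /eqP i0; rewrite prednK// lt0n.
have := ltn_ord i; rewrite leq_eqVlt => /orP[/eqP ->|iS].
  by rewrite ltnn eqxx.
by rewrite iS ltn_eqF.
Qed.

Lemma laplacian_mx_metzler nu h n i j :
  0 <= nu -> i != j -> 0 <= laplacian_mx nu h n i j.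
Proof.
move=> nu0 ij; rewrite !mxE (negPf ij) mulr_ge0 ?divr_ge0 ?sqr_ge0//.
by case: ifP.
Qed.

(** A kernel vector, extended by 0 at both ends, has zero second difference, so
it is affine with two zeros. *)
Lemma laplacian_mx_unit nu h n :
  0 < nu -> 0 < h -> laplacian_mx nu h n \in unitmx.
Proof.
move=> nu0 h0; have c0 : nu / h ^+ 2 != 0.
  by rewrite gt_eqF// divr_gt0// exprn_gt0.
suff ker0 (v : 'cV[R]_n) : laplacian_mx nu h n *m v = 0 -> v = 0.
  rewrite -unitmx_tr -row_free_unit; apply: inj_row_free => v.
  rewrite -[v]trmxK -trmx_mul => /(congr1 trmx).
  by rewrite !trmxK trmx0 => /ker0 vT0; rewrite -[v]trmxK vT0 trmx0.
move=> Av.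
pose w := entry v.
have vE : v = \col_j w j.+1 by apply/colP => j; rewrite mxE /w entry_ord.
have w_rec j : (j < n)%N -> w j - 2 * w j.+1 + w j.+2 = 0.
  move=> jn; have := mul_laplacian_mx nu h w (Ordinal jn).
  rewrite -vE Av mxE => /esym/eqP.
  rewrite mulf_eq0 (negPf c0) orFb [nat_of_ord _]/= => /eqP H; rewrite -[RHS]H.
  congr (_ - _ + _); first by case: eqP => // ->.
  by case: eqP => [jn'|//]; apply: entry_out; rewrite jn'.
have w_lin j : (j <= n)%N -> w j = j%:R * w 1%N /\ w j.+1 = j.+1%:R * w 1%N.
  elim: j => [|j IH] jn; first by rewrite mul0r mul1r.
  have [wj wj1] := IH (ltnW jn); split => //.
  by have := w_rec j jn; rewrite wj wj1 -!natr1 => H; lra.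
have w1 : w 1%N = 0.
  have [_ /esym/eqP] := w_lin n (leqnn n).
  by rewrite [w n.+1]entry_out// mulf_eq0 pnatr_eq0 /= => /eqP.
apply/colP => j; rewrite -entry_ord mxE.
by have [_] := w_lin j (ltnW (ltn_ord j)); rewrite w1 mulr0.
Qed.

(** Only the boundary neighbours missing from the matrix survive; they are the
boundary terms of a load vector. *)
Lemma mul_laplacian_affine nu h n (x y : R) :
  laplacian_mx nu h n *m (\col_(i < n) (x + y * i.+1%:R)) =
  - load_vec nu h n (fun=> 0) x (x + y * n.+1%:R).
Proof.
apply/colP => i.
rewrite (mul_laplacian_mx nu h (fun j => x + y * j%:R)) !mxE add0r.
have -> : (i.+2%:R = i%:R + 2 :> R) by rewrite -addn2 natrD.
have -> : (i.+1%:R = i%:R + 1 :> R) by rewrite -addn1 natrD.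
have H : i.+1 == n -> (n.+1%:R : R) = i%:R + 2
  by move=> /eqP iN; rewrite -natrD addn2 -(congr1 S iN).
case: (eqVneq (i : nat) 0%N) => [i0|_].
  case: eqVneq => [/eqP iN|_]; rewrite ?(H iN) ?i0 /=; ring.
by case: eqVneq => [/eqP iN|_]; rewrite ?(H iN) /=; ring.
Qed.

Lemma load_vec_ge0 nu h n (a b : R) i :
  0 <= nu -> 0 <= a -> 0 <= b -> 0 <= load_vec nu h n (fun=> 0) a b i 0.
Proof.
move=> nu0 a0 b0; rewrite mxE add0r.
have c0 : 0 <= nu / h ^+ 2 by rewrite divr_ge0 ?sqr_ge0.
by apply: addr_ge0; case: ifP => // _; exact: mulr_ge0.
Qed.

Lemma load_vecB_right nu h n g (a b b' : R) :
  load_vec nu h n g a b - load_vec nu h n g a b' =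
  (b - b') *: load_vec nu h n (fun=> 0) 0 1.
Proof. by apply/colP => i; rewrite !mxE; case: ifP; case: ifP => _ _; ring. Qed.

Lemma load_vecB_left nu h n g (a a' b : R) :
  load_vec nu h n g a b - load_vec nu h n g a' b =
  (a - a') *: load_vec nu h n (fun=> 0) 1 0.
Proof. by apply/colP => i; rewrite !mxE; case: ifP; case: ifP => _ _; ring. Qed.

End Laplacian.

(** * Maxima over the time grid *)

Section TimeNorms.
Context {R : realType}.

Lemma time_max_ge0 M (a : nat -> R) : 0 <= time_max M a.
Proof.
by rewrite /time_max; elim/big_ind: _ => // x y x0 y0; rewrite le_max x0.
Qed.

Lemma le_time_max M (a : nat -> R) m :
  (0 < m)%N -> (m <= M)%N -> `|a m| <= time_max M a.
Proof.
move=> m0 mM; apply: (@le_bigmax_seq _ _ _ _ _ m) => //.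
by rewrite mem_index_iota m0.
Qed.

Lemma time_max_le M (a : nat -> R) B : 0 <= B ->
  (forall m, (m <= M)%N -> `|a m| <= B) -> time_max M a <= B.
Proof.
move=> B0 aB; rewrite /time_max big_nat.
by elim/big_ind: _ => // [x y xB yB|m /andP[_ mM]]; rewrite ?ge_max ?xB ?aB.
Qed.

Lemma time_sup_norm_ge0 M n (v : nat -> 'cV[R]_n) : 0 <= time_sup_norm M v.
Proof.
rewrite /time_sup_norm; elim/big_ind: _ => // [x y x0 y0|m _].
  by rewrite le_max x0.
by elim/big_ind: _ => // x y x0 y0; rewrite le_max x0.
Qed.

Lemma time_sup_norm_le M n (v : nat -> 'cV[R]_n) B : 0 <= B ->
  (forall m j, (m <= M)%N -> `|v m j 0| <= B) -> time_sup_norm M v <= B.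
Proof.
move=> B0 vB; rewrite /time_sup_norm big_nat.
elim/big_ind: _ => // [x y xB yB|m /andP[_ mM]]; first by rewrite ge_max xB.
by elim/big_ind: _ => // [x y xB yB|j _]; rewrite ?ge_max ?xB ?vB.
Qed.

End TimeNorms.

(** * Error propagation between the subdomains *)

Section Subdomains.
Context {R : realType}.
Implicit Types (nu h dt : R) (n M : nat) (sch : etd_scheme) (eps : nat -> R).

(** With the interface at the right end, as for the left subdomain, the steady
state is the linear ramp from 0 to 1. *)
Lemma le_etd_error_right_load nu h dt n M sch (e : nat -> 'cV[R]_n) eps (d : R) :
  0 < nu -> 0 < h -> 0 < dt -> e 0%N = 0 ->
  (forall m, (m < M)%N -> e m.+1 = etd_step sch dt (laplacian_mx nu h n) (e m)
     (eps m *: load_vec nu h n (fun=> 0) 0 1)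
     (eps m.+1 *: load_vec nu h n (fun=> 0) 0 1)) ->
  (forall m, (m <= M)%N -> `|eps m| <= d) ->
  forall m i, (m <= M)%N -> `|e m i 0| <= d * (i.+1%:R / n.+1%:R).
Proof.
move=> nu0 h0 dt0 e0 eS eps_d m i mM.
pose s : 'cV[R]_n := \col_(i < n) (0 + (n.+1%:R)^-1 * i.+1%:R).
have -> : i.+1%:R / n.+1%:R = s i 0 by rewrite mxE add0r mulrC.
apply: (le_etd_trajectory (s := s) _ _ _ _ _ dt0 e0 eS eps_d i mM).
- exact: laplacian_mx_unit.
- by move=> a b; apply: laplacian_mx_metzler; exact: ltW.
- by move=> k; apply: load_vec_ge0 => //; exact: ltW.
- by move=> k; rewrite mxE add0r mulr_ge0 ?invr_ge0.
- by rewrite mul_laplacian_affine add0r mulVf ?pnatr_eq0.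
Qed.

(** With the interface at the left end, as for the right subdomain, the steady
state is the linear ramp from 1 to 0. *)
Lemma le_etd_error_left_load nu h dt n M sch (e : nat -> 'cV[R]_n) eps (d : R) :
  0 < nu -> 0 < h -> 0 < dt -> e 0%N = 0 ->
  (forall m, (m < M)%N -> e m.+1 = etd_step sch dt (laplacian_mx nu h n) (e m)
     (eps m *: load_vec nu h n (fun=> 0) 1 0)
     (eps m.+1 *: load_vec nu h n (fun=> 0) 1 0)) ->
  (forall m, (m <= M)%N -> `|eps m| <= d) ->
  forall m i, (m <= M)%N -> `|e m i 0| <= d * (1 - i.+1%:R / n.+1%:R).
Proof.
move=> nu0 h0 dt0 e0 eS eps_d m i mM.
pose s : 'cV[R]_n := \col_(i < n) (1 + - (n.+1%:R)^-1 * i.+1%:R).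
have -> : 1 - i.+1%:R / n.+1%:R = s i 0 by rewrite mxE mulNr mulrC.
apply: (le_etd_trajectory (s := s) _ _ _ _ _ dt0 e0 eS eps_d i mM).
- exact: laplacian_mx_unit.
- by move=> a b; apply: laplacian_mx_metzler; exact: ltW.
- by move=> k; apply: load_vec_ge0 => //; exact: ltW.
- move=> k; rewrite mxE mulNr subr_ge0 mulrC ler_pdivrMr// mul1r ler_nat.
  exact/ltnW/ltn_ord.
- by rewrite mul_laplacian_affine mulNr mulVf ?pnatr_eq0// subrr.
Qed.

(** In the application x and y are the interface errors of the two subdomains,
each of which is produced from the other one by the previous iteration. *)
Lemma alternating_contraction (a b : R) (x y : nat -> R) :
  0 <= a -> 0 <= b ->
  (forall k, x k.+1 <= a * y k) -> (forall k, y k.+1 <= b * x k) ->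
  forall k, x (2 * k)%N <= (a * b) ^+ k * x 0%N.
Proof.
move=> a0 b0 xS yS; elim=> [|k IH]; first by rewrite expr0 mul1r.
have -> : (2 * k.+1 = (2 * k).+2)%N by lia.
rewrite (le_trans (xS _))// exprS -!mulrA ler_wpM2l//.
by rewrite (le_trans (yS _))// ler_wpM2l.
Qed.

(** The sum contracts by the larger of the two factors at every step. *)
Lemma alternating_cvg0 (a b : R) (x y : nat -> R) :
  0 <= a -> a < 1 -> 0 <= b -> b < 1 ->
  (forall k, 0 <= x k) -> (forall k, 0 <= y k) ->
  (forall k, x k.+1 <= a * y k) -> (forall k, y k.+1 <= b * x k) ->
  (fun k => x k + y k) @ \oo --> (0 : R).
Proof.
move=> a0 a1 b0 b1 x0 y0 xS yS.
pose r := Num.max a b.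
have r0 : 0 <= r by rewrite le_max a0.
have r1 : r < 1 by rewrite gt_max a1.
have le_r k : x k + y k <= (x 0%N + y 0%N) * r ^+ k.
  elim: k => [|k IH]; first by rewrite expr0 mulr1.
  rewrite exprS mulrCA (le_trans (lerD (xS k) (yS k)))//.
  apply: (@le_trans _ _ (r * (x k + y k))); last by rewrite ler_wpM2l.
  rewrite mulrDr addrC lerD// ler_wpM2r// /r le_max lexx ?orbT//.
have cr : (fun k => (x 0%N + y 0%N) * r ^+ k) @ \oo --> (0 : R).
  rewrite -[X in _ --> X](mulr0 (x 0%N + y 0%N)).
  by apply: cvgMl_tmp; apply: cvg_expr; rewrite ger0_norm.
apply: (squeeze_cvgr _ (cvg_cst 0) cr).
by near=> k; rewrite addr_ge0//= le_r.
Unshelve. all: by end_near. Qed.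

End Subdomains.

Theorem theorem4p7 (R : realType) (P : ddproblem R) (alpha beta : R)
  (nu_gt0 : 0 < nu P) (len_gt0 : 0 < len P) (final_time_gt0 : 0 < final_time P)
  (Mt_gt0 : (0 < Mt P)%N)
  (alpha_gt0 : 0 < alpha) (alpha_lt_beta : alpha < beta) (beta_lt1 : beta < 1)
  (alphaE : alpha * len P = (Nalpha P)%:R * mesh P)
  (betaE : beta * len P = (Nbeta P)%:R * mesh P)
  (Nalpha_gt1 : (1 < Nalpha P)%N) (Nalpha_lt_Nbeta : (Nalpha P < Nbeta P)%N)
  (Nbeta_lt_Nx : (Nbeta P < Nx P)%N)
  (s : etd_scheme)
  (u1 : nat -> 'cV[R]_(N1 P)) (u2 : nat -> 'cV[R]_(N2 P))
  (hu : is_localized_etd s u1 u2)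
  (g1 g2 : nat -> R)
  (u1k : nat -> nat -> 'cV[R]_(N1 P)) (u2k : nat -> nat -> 'cV[R]_(N2 P))
  (huk : is_method2 s g1 g2 u1k u2k) :
  ((fun k : nat => time_sup_norm (Mt P) (fun m => u1k k m - u1 m)
                   + time_sup_norm (Mt P) (fun m => u2k k m - u2 m))
     @ \oo --> (0 : R)) /\
  (forall k : nat,
     time_sup_norm (Mt P) (fun m => u1k (2 * k + 1)%N m - u1 m)
       <= kappa alpha beta ^+ k
          * time_max (Mt P) (fun m => g2 m - entry (u2 m) (Nba P)) /\
     time_sup_norm (Mt P) (fun m => u2k (2 * k + 1)%N m - u2 m)
       <= kappa alpha beta ^+ k
          * time_max (Mt P) (fun m => g1 m - entry (u1 m) (Nalpha P))).
Proof.
have N1E : (N1 P).+1 = Nbeta P by rewrite /N1; lia.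
have N2E : (N2 P).+1 = ((Nx P).+1 - Nalpha P)%N by rewrite /N2; lia.
have NbaE : (Nba P + Nalpha P)%N = Nbeta P by rewrite /Nba; lia.
have h0 : 0 < mesh P by rewrite divr_gt0.
have dt0 : 0 < tstep P by rewrite divr_gt0// ltr0n.
have gridE (g : R) k : g * len P = k%:R * mesh P -> g = k%:R / (Nx P).+1%:R.
  rewrite /mesh mulrCA [g * _]mulrC => /mulfI; apply; exact: lt0r_neq0.
have {alphaE}aE := gridE _ _ alphaE; have {betaE gridE}bE := gridE _ _ betaE.
have beta_gt0 := lt_trans alpha_gt0 alpha_lt_beta.
have alpha_lt1 := lt_trans alpha_lt_beta beta_lt1.
have Nx_neq0 : (Nx P).+1%:R != 0 :> R by rewrite pnatr_eq0.
(* the two steady states at the points sent to the other subdomain *)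
have ratio1 : (Nalpha P)%:R / (N1 P).+1%:R = alpha / beta.
  by rewrite N1E aE bE invf_div mulrA divfK.
have ratio2 : 1 - (Nba P)%:R / (N2 P).+1%:R = (1 - beta) / (1 - alpha).
  have Nx_alpha : (N2 P).+1%:R = (Nx P).+1%:R * (1 - alpha) :> R.
    by rewrite N2E natrB; [rewrite aE; field | lia].
  have : (Nba P)%:R = (Nx P).+1%:R * (beta - alpha) :> R.
    by rewrite aE bE -NbaE natrD; field.
  rewrite Nx_alpha => ->; field.
  by rewrite nat1r Nx_neq0 subr_eq0 gt_eqF.
case: hu => u10 u20 uS; case: huk => uk0 ukS.
set w1 := interface _ g1 u1k _ in ukS; set w2 := interface _ g2 u2k _ in ukS.
pose eps1 k m := w1 k m - entry (u1 m) (Nalpha P).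
pose eps2 k m := w2 k m - entry (u2 m) (Nba P).
pose d1 k := time_max (Mt P) (eps1 k); pose d2 k := time_max (Mt P) (eps2 k).
have d1_ge0 k : 0 <= d1 k := time_max_ge0 _ _.
have d2_ge0 k : 0 <= d2 k := time_max_ge0 _ _.
have NaN1 : ((Nalpha P).-1 < N1 P)%N by rewrite /N1; lia.
have NbaN2 : ((Nba P).-1 < N2 P)%N by rewrite /N2 /Nba; lia.
have entry1 (v : 'cV[R]_(N1 P)) : entry v (Nalpha P) = v (Ordinal NaN1) 0.
  by rewrite -entryE prednK//; lia.
have entry2 (v : 'cV[R]_(N2 P)) : entry v (Nba P) = v (Ordinal NbaN2) 0.
  by rewrite -entryE prednK// /Nba; lia.
have NaS : (Nalpha P).-1.+1 = Nalpha P by lia.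
have NbaS : (Nba P).-1.+1 = Nba P by rewrite /Nba; lia.
(* At time 0 the prescribed interface values are the initial data, so the
   maxima over 1 <= m <= M also bound the interface errors at m = 0. *)
have eps1_0 k : eps1 k 0%N = 0.
  by rewrite /eps1 /w1 /interface eqxx u10 entry1 mxE /= NaS subrr.
have eps2_0 k : eps2 k 0%N = 0.
  by rewrite /eps2 /w2 /interface eqxx u20 entry2 mxE /= NbaS NbaE subrr.
have le_eps1 k m : (m <= Mt P)%N -> `|eps1 k m| <= d1 k.
  by case: m => [|m] mM; [rewrite eps1_0 normr0 | exact: le_time_max].
have le_eps2 k m : (m <= Mt P)%N -> `|eps2 k m| <= d2 k.
  by case: m => [|m] mM; [rewrite eps2_0 normr0 | exact: le_time_max].
have err1 k m i : (m <= Mt P)%N ->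
    `|(u1k k.+1 m - u1 m) i 0| <= d2 k * (i.+1%:R / (N1 P).+1%:R).
  move=> mM; apply: (le_etd_error_right_load (e := fun m => u1k k.+1 m - u1 m)
    (sch := s) nu_gt0 h0 dt0 _ _ (le_eps2 k) i mM).
    by rewrite u10 (uk0 k).1 subrr.
  move=> m' m'M; rewrite (uS m' m'M).1 (ukS k m' m'M).1 etd_stepB.
  by rewrite !load_vecB_right.
have err2 k m i : (m <= Mt P)%N ->
    `|(u2k k.+1 m - u2 m) i 0| <= d1 k * (1 - i.+1%:R / (N2 P).+1%:R).
  move=> mM; apply: (le_etd_error_left_load (e := fun m => u2k k.+1 m - u2 m)
    (sch := s) nu_gt0 h0 dt0 _ _ (le_eps1 k) i mM).
    by rewrite u20 (uk0 k).2 subrr.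
  move=> m' m'M; rewrite (uS m' m'M).2 (ukS k m' m'M).2 etd_stepB.
  by rewrite !load_vecB_left.
have norm1 k : time_sup_norm (Mt P) (fun m => u1k k.+1 m - u1 m) <= d2 k.
  apply: time_sup_norm_le => // m i mM; apply: le_trans (err1 k m i mM) _.
  by rewrite ler_piMr// ler_pdivrMr// mul1r ler_nat; exact/ltnW/ltn_ord.
have norm2 k : time_sup_norm (Mt P) (fun m => u2k k.+1 m - u2 m) <= d1 k.
  apply: time_sup_norm_le => // m i mM; apply: le_trans (err2 k m i mM) _.
  by rewrite ler_piMr// lerBlDr lerDl divr_ge0.
have r1_ge0 : 0 <= alpha / beta by rewrite divr_ge0 ?ltW.
have r2_ge0 : 0 <= (1 - beta) / (1 - alpha) by rewrite divr_ge0 ?subr_ge0 ?ltW.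
have d1S k : d1 k.+1 <= alpha / beta * d2 k.
  apply: time_max_le => [|[|m] mM]; first exact: mulr_ge0.
    by rewrite eps1_0 normr0 mulr_ge0.
  rewrite /eps1 /w1 /interface /= -entryB entry1 mulrC -ratio1.
  by apply: le_trans (err1 k m.+1 _ mM) _; rewrite /= NaS.
have d2S k : d2 k.+1 <= (1 - beta) / (1 - alpha) * d1 k.
  apply: time_max_le => [|[|m] mM]; first exact: mulr_ge0.
    by rewrite eps2_0 normr0 mulr_ge0.
  rewrite /eps2 /w2 /interface /= -entryB entry2 mulrC -ratio2.
  by apply: le_trans (err2 k m.+1 _ mM) _; rewrite /= NbaS.
split.
  rewrite -cvg_shiftS.
  have r1_lt1 : alpha / beta < 1 by rewrite ltr_pdivrMr// mul1r.
  have r2_lt1 : (1 - beta) / (1 - alpha) < 1.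
    by rewrite ltr_pdivrMr ?subr_gt0// mul1r ltrD2l ltrN2.
  apply: (squeeze_cvgr _ (cvg_cst 0)
    (alternating_cvg0 r1_ge0 r1_lt1 r2_ge0 r2_lt1 d1_ge0 d2_ge0 d1S d2S)).
  near=> k; rewrite addr_ge0 ?time_sup_norm_ge0//=.
  by rewrite addrC lerD.
(* time 0, where [interface] ignores the guess, is outside the maximum *)
have d1_init : d1 0%N = time_max (Mt P) (fun m => g1 m - entry (u1 m) (Nalpha P)).
  by rewrite /d1 /time_max !big_nat; apply: eq_bigr => -[].
have d2_init : d2 0%N = time_max (Mt P) (fun m => g2 m - entry (u2 m) (Nba P)).
  by rewrite /d2 /time_max !big_nat; apply: eq_bigr => -[].
have kappaE : kappa alpha beta = alpha / beta * ((1 - beta) / (1 - alpha)).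
  by rewrite /kappa mulf_div.
move=> k; rewrite addn1 -d1_init -d2_init kappaE; split.
  apply: le_trans (norm1 _) _; rewrite [_ / _ * _]mulrC.
  exact: alternating_contraction r2_ge0 r1_ge0 d2S d1S k.
apply: le_trans (norm2 _) _.
exact: alternating_contraction r1_ge0 r2_ge0 d1S d2S k.
Unshelve. all: by end_near. Qed.
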